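(* Let $N=\{1,\dots,n\}$ index the points to be clustered, let $d(i,j)$ ($i,j\in N$) be a real-valued distance with $d(i,i)=0$, let $k$ with $1\le k\le n$ be the number of clusters, and run the Primary MinMax Starting Method (defined in the context). Consider any iteration $k_o\in\{k,k-1,\dots,1\}$. Let $N_o\subseteq N$ be the set of available points at that iteration (before it is updated), let $n_o=|N_o|$ and $v=\mathrm{ClusterSize}=\lceil n_o/k_o\rceil$, and let $\mathrm{CSet}=\{C\subseteq N_o: |C|=v\}$. Call $C_{best}\in\mathrm{CSet}$ a best cluster if it minimizes $\mathrm{MMSpan}(C)$ over all $C\in\mathrm{CSet}$. Then the cluster $C(k_o)$ and the associated point $i^*$ identified at the conclusion of iteration $k_o$ respectively qualify to be $C_{best}$ and its MinMax-centroid; that is, $C(k_o)\in\mathrm{CSet}$, $$\mathrm{MMSpan}(C(k_o))=\min\{\mathrm{MMSpan}(C): C\subseteq N_o,\ |C|=v\},$$ and $i^*$ is a MinMax-centroid of $C(k_o)$.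
   Context: The distance $d$ is not required to be a metric or to be non-negative; only the convention $d(i,i)=0$ is adopted. For a set $C\subseteq N$ and $i\in C$, put $\mathrm{MaxDist}(i:C)=\max\{d(i,j): j\in C\setminus\{i\}\}$. A MinMax-centroid of $C$ is a point $i^*\in C$ with $\mathrm{MaxDist}(i^*:C)=\min\{\mathrm{MaxDist}(i:C): i\in C\}$, and this minimum value is denoted $\mathrm{MMSpan}(C)$. Primary MinMax Starting Method. Preprocessing: for each $i\in N$ create an ordering $i(1),i(2),\dots,i(n-1)$ of $N\setminus\{i\}$ with $d(i,i(1))\le d(i,i(2))\le\dots\le d(i,i(n-1))$. Initialize $N_o=N$, $n_o=n$. For $k_o=k,k-1,\dots,1$ do the following. 1. Set $\mathrm{ClusterSize}=\lceil n_o/k_o\rceil$ and $\mathrm{ScanSize}=\mathrm{ClusterSize}-1$. 2. (MinMax Distance Algorithm.) Set $\mathrm{BestDistance}=\mathit{Large}$, a large positive number. For each $i\in N_o$: set $\mathrm{Scan}=0$; for $s=1,\dots,n-1$, let $j=i(s)$ and, if $j\in N_o$, increase $\mathrm{Scan}$ by 1 and leave the loop over $s$ if $\mathrm{Scan}=\mathrm{ScanSize}$. (Thus the scan stops at the $\mathrm{ScanSize}$-th point of the ordered list of $i$ that belongs to $N_o$.) Then, for the last $j$ reached, if $d(i,j)<\mathrm{BestDistance}$, set $i^*=i$ and $\mathrm{BestDistance}=d(i,j)$. 3. (Generate $C(k_o)$ and update $N_o$.) Start with $C(k_o)=\emptyset$ and $\mathrm{Scan}=0$. For $s=1,\dots,n-1$,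 let $j=i^*(s)$ and, if $j\in N_o$, increase $\mathrm{Scan}$ by 1, move $j$ from $N_o$ to $C(k_o)$, and leave the loop if $\mathrm{Scan}=\mathrm{ScanSize}$. Then move $i^*$ from $N_o$ to $C(k_o)$, record $i^*$ as the point associated with $C(k_o)$, and replace $n_o$ by $n_o-\mathrm{ClusterSize}$. (Thus $C(k_o)$ consists of $i^*$ and the first $\mathrm{ScanSize}$ points of its ordered list that were in $N_o$.) *)

(* Defs.v *)
From HB Require Import structures.
From mathcomp Require Import all_boot all_order all_algebra.

Set Implicit Arguments.
Unset Strict Implicit.
Unset Printing Implicit Defensive.

Import Order.TTheory GRing.Theory Num.Theory.
Local Open Scope ring_scope.

(* Distances may be negative, so extrema are taken without any neutral element:
   the head of the list is the starting value.  The value on the empty list is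
   0; it only matters for MaxDist(i : {i}), which is thus d(i,i) = 0. *)
Definition max_seq (R : realFieldType) (s : seq R) : R :=
  if s is x :: s' then \big[Num.max/x]_(y <- s') y else 0.

Definition min_seq (R : realFieldType) (s : seq R) : R :=
  if s is x :: s' then \big[Num.min/x]_(y <- s') y else 0.

Definition MaxDist (R : realFieldType) (n : nat) (d : 'I_n -> 'I_n -> R)
    (i : 'I_n) (C : {set 'I_n}) : R :=
  max_seq [seq d i j | j in C :\ i].

Definition MMSpan (R : realFieldType) (n : nat) (d : 'I_n -> 'I_n -> R)
    (C : {set 'I_n}) : R :=
  min_seq [seq MaxDist d i C | i in C].

Definition MinMax_centroid (R : realFieldType) (n : nat)
    (d : 'I_n -> 'I_n -> R) (C : {set 'I_n}) (i : 'I_n) : Prop :=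
  i \in C /\ MaxDist d i C = MMSpan d C.

Definition CSet (n : nat) (No : {set 'I_n}) (v : nat) : {set {set 'I_n}} :=
  [set C : {set 'I_n} | (C \subset No) && (#|C| == v)].

Definition best_cluster (R : realFieldType) (n : nat)
    (d : 'I_n -> 'I_n -> R) (No : {set 'I_n}) (v : nat) (C : {set 'I_n})
    : Prop :=
  C \in CSet No v /\
  MMSpan d C = min_seq [seq MMSpan d C' | C' in CSet No v].

(* [l] is i(1), ..., i(n-1). *)
Definition distance_ordering (R : realFieldType) (n : nat)
    (d : 'I_n -> 'I_n -> R) (i : 'I_n) (l : seq 'I_n) : Prop :=
  perm_eq l (enum [set~ i]) /\ sorted (fun j j' => d i j <= d i j') l.

Definition cluster_size (no ko : nat) : nat :=
  `|Num.ceil (no%:Q / ko%:Q)|%N.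

(* In both loops below [l] is the part of the ordered list not yet visited.
   The exit test Scan = ScanSize precedes each step instead of following each
   increment of Scan.  This is the same loop when ScanSize >= 1; when
   ScanSize = 0 it makes the scan stop at once, as it should for a singleton
   cluster. *)

(* Returns the last point reached, [j] being the last one reached so far. *)
Fixpoint scan_loop (n : nat) (No : {set 'I_n}) (ScanSize Scan : nat)
    (j : 'I_n) (l : seq 'I_n) : 'I_n :=
  if Scan == ScanSize then j
  else if l is j' :: l' then
    scan_loop No ScanSize (if j' \in No then Scan.+1 else Scan) j' l'
  else j.

(* The scan for [i] starts at "i(0)" = i, which is the point returned when
   ScanSize = 0.  The pair [best] is (i*, BestDistance), with i* = None as long
   as i* is unassigned. *)
Definition update_best (R : realFieldType) (n : nat)
    (d : 'I_n -> 'I_n -> R) (ordl : 'I_n -> seq 'I_n) (No : {set 'I_n})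
    (ScanSize : nat) (best : option 'I_n * R) (i : 'I_n)
    : option 'I_n * R :=
  let j := scan_loop No ScanSize 0 i (ordl i) in
  if d i j < best.2 then (Some i, d i j) else best.

(* [points] lists the available points in the order in which they are tried. *)
Definition MinMax_distance_algorithm (R : realFieldType) (n : nat)
    (d : 'I_n -> 'I_n -> R) (ordl : 'I_n -> seq 'I_n) (Large : R)
    (No : {set 'I_n}) (ScanSize : nat) (points : seq 'I_n) : option 'I_n :=
  (foldl (update_best d ordl No ScanSize) (None, Large) points).1.

(* Returns the updated pair (N_o, C). *)
Fixpoint generate_loop (n : nat) (ScanSize Scan : nat) (No C : {set 'I_n})
    (l : seq 'I_n) : {set 'I_n} * {set 'I_n} :=
  if Scan == ScanSize then (No, C)
  else if l is j :: l' then
    if j \in No then generate_loop ScanSize Scan.+1 (No :\ j) (j |: C) l'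
    else generate_loop ScanSize Scan No C l'
  else (No, C).

(* [navail] is the program variable n_o, updated by subtraction and not
   recomputed as the cardinal of N_o. *)
Record state (n : nat) := State {
  avail : {set 'I_n};
  navail : nat
}.

Record outcome (n : nat) := Outcome {
  next_state : state n;
  cluster : {set 'I_n};
  center : option 'I_n
}.

Definition iteration (R : realFieldType) (n : nat)
    (d : 'I_n -> 'I_n -> R) (ordl : 'I_n -> seq 'I_n)
    (visit : {set 'I_n} -> seq 'I_n) (Large : R) (ko : nat) (st : state n)
    : outcome n :=
  let No := avail st in
  let ClusterSize := cluster_size (navail st) ko in
  let ScanSize := (ClusterSize - 1)%N in
  let istar :=
    MinMax_distance_algorithm d ordl Large No ScanSize (visit No) in
  if istar is Some i then
    let: (No', C) := generate_loop ScanSize 0 No set0 (ordl i) in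
    Outcome (State (No' :\ i) (navail st - ClusterSize)) (i |: C) (Some i)
  else Outcome st set0 None.

(* State reached after the [t] iterations k_o = k, k-1, ..., k-t+1. *)
Fixpoint state_after (R : realFieldType) (n : nat)
    (d : 'I_n -> 'I_n -> R) (ordl : 'I_n -> seq 'I_n)
    (visit : {set 'I_n} -> seq 'I_n) (Large : R) (k t : nat) : state n :=
  if t is t'.+1 then
    next_state (iteration d ordl visit Large (k - t')
                  (state_after d ordl visit Large k t'))
  else State [set: 'I_n] n.

(* Main.v *)
(** Let [s = ClusterSize - 1].  Among all clusters [C] of size [s.+1] that
    contain [i], the value [MaxDist i C] is least when [C] consists of [i] and
    its [s] nearest available points, and this least value [radius i] is the
    distance at which the scan of [i] stops.  The algorithm picks [i*]
    minimizing [radius], so for every cluster [C] with centroid [i],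
    [MMSpan C = MaxDist i C >= radius i >= radius i* = MaxDist i* C(ko)
     >= MMSpan (C(ko))]. *)

Require Import Defs.
From mathcomp Require Import all_boot all_order all_algebra.
From mathcomp Require Import zify.
Set Implicit Arguments.
Unset Strict Implicit.
Unset Printing Implicit Defensive.
Import Order.TTheory GRing.Theory Num.Theory.
Local Open Scope ring_scope.

(** * Extrema of nonempty lists, and the span of a cluster *)

Lemma max_seq_ge (R : realFieldType) (s : seq R) (x : R) :
  x \in s -> x <= max_seq s.
Proof.
case: s => // y s; rewrite inE /= => /orP[/eqP -> | xs].
  exact: bigmax_ge_id.
exact: (le_bigmax_seq _ _ xpredT id xs).
Qed.

Lemma max_seq_in (R : realFieldType) (s : seq R) :
  s != [::] -> max_seq s \in s.
Proof.
case: s => // x s _ /=; elim: s => [|y s IHs]; first by rewrite big_nil mem_head.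
rewrite big_cons maxEle; case: ifP => _; last by rewrite !inE eqxx orbT.
by move: IHs; rewrite !inE => /orP[-> // | ->]; rewrite !orbT.
Qed.

Lemma min_seq_le (R : realFieldType) (s : seq R) (x : R) :
  x \in s -> min_seq s <= x.
Proof.
case: s => // y s; rewrite inE /= => /orP[/eqP -> | xs].
  exact: bigmin_le_id.
exact: (ge_bigmin_seq _ _ xpredT id xs).
Qed.

Lemma min_seq_in (R : realFieldType) (s : seq R) :
  s != [::] -> min_seq s \in s.
Proof.
case: s => // x s _ /=; elim: s => [|y s IHs]; first by rewrite big_nil mem_head.
rewrite big_cons minEle; case: ifP => _; first by rewrite !inE eqxx orbT.
by move: IHs; rewrite !inE => /orP[-> // | ->]; rewrite !orbT.
Qed.

Lemma image_neq_nil (T : finType) (T' : eqType) (f : T -> T') (A : {set T}) x :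
  x \in A -> [seq f y | y in A] != [::].
Proof. by move=> xA; apply/eqP => E; have := image_f f xA; rewrite E. Qed.

Lemma MMSpan_attained (R : realFieldType) (n : nat) (d : 'I_n -> 'I_n -> R)
    (C : {set 'I_n}) (i : 'I_n) :
  i \in C -> exists2 j, j \in C & MMSpan d C = MaxDist d j C.
Proof.
move=> iC; have /imageP[j jC E] :=
  min_seq_in (image_neq_nil (fun j => MaxDist d j C) iC).
by exists j.
Qed.

Lemma MMSpan_le (R : realFieldType) (n : nat) (d : 'I_n -> 'I_n -> R)
    (C : {set 'I_n}) (i : 'I_n) :
  i \in C -> MMSpan d C <= MaxDist d i C.
Proof.
move=> iC; exact: min_seq_le (image_f (fun j => MaxDist d j C) iC).
Qed.

(** These bounds characterize the ceiling of [no / ko] inside [nat]. The strict one is what later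
    guarantees that an iteration leaves a point for each remaining cluster. *)
Lemma cluster_size_bounds (no ko : nat) : (0 < ko)%N -> (0 < no)%N ->
  [/\ (0 < cluster_size no ko)%N, ((cluster_size no ko).-1 * ko < no)%N
    & (no <= cluster_size no ko * ko)%N].
Proof.
move=> ko0 no0; rewrite /cluster_size.
have koQ : 0 < ko%:Q by rewrite ltr0n.
have : 0 < Num.ceil (no%:Q / ko%:Q) by rewrite ceil_gt0 divr_gt0 ?ltr0n.
have := ceilB1_lt (no%:Q / ko%:Q); have := ceil_ge (no%:Q / ko%:Q).
case: (Num.ceil _) => // v; rewrite ler_pdivrMr // ltr_pdivlMr // absz_nat.
rewrite -!intrM !ltr_int !ler_int.
by split; lia.
Qed.

(** * Closed forms of the loops, and the choice of the center *)

Definition nearest (n : nat) (No : {set 'I_n}) (s : nat) (l : seq 'I_n) :=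
  take s [seq j <- l | j \in No].

(** The size hypothesis ensures that the scan ends by its exit test: a scan that exhausts [l]
    returns the last point visited, which may lie outside [No]. The counter [c] and the point [j]
    are arbitrary for the sake of the induction. *)
Lemma scan_loopE (n : nat) (No : {set 'I_n}) (s c : nat) (j : 'I_n)
    (l : seq 'I_n) :
  (c <= s)%N -> (s - c <= size [seq x <- l | x \in No])%N ->
  scan_loop No s c j l = last j (nearest No (s - c) l).
Proof.
rewrite /nearest; elim: l c j => [|x l IHl] c j cs /= sz.
  by rewrite if_same.
case: eqP => [->|/eqP cs']; first by rewrite subnn take0.
have {}cs : (c < s)%N by rewrite ltn_neqAle cs' cs.
case: ifP sz => xNo sz; last first.
  rewrite (IHl _ _ (ltnW cs) sz).
  rewrite -[(s - c)%N]prednK ?subn_gt0 //= in sz *.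
  by case: [seq _ <- l | _] sz.
rewrite IHl //; last by move: sz => /=; lia.
by rewrite -[(s - c)%N]prednK ?subn_gt0 //= subnS.
Qed.

Lemma generate_loopE (n : nat) (s c : nat) (No C : {set 'I_n})
    (l : seq 'I_n) :
  uniq l -> (c <= s)%N ->
  generate_loop s c No C l =
    (No :\: [set x in nearest No (s - c) l],
     [set x in nearest No (s - c) l] :|: C).
Proof.
rewrite /nearest; elim: l c No C => [|x l IHl] c No C /= => [_ _|/andP[xl ul] cs].
  by rewrite if_same set_nil setD0 set0U.
case: eqP => [->|/eqP cs'].
  by rewrite subnn take0 set_nil setD0 set0U.
have {}cs : (c < s)%N by rewrite ltn_neqAle cs' cs.
case: ifP => xNo; last by rewrite IHl // ltnW.
rewrite IHl // -[(s - c)%N]prednK ?subn_gt0 //= -subnS.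
(* Taking [x] out of [No] leaves the rest of the scan unchanged, as [x] does not recur in [l]. *)
have -> : [seq y <- l | y \in No :\ x] = [seq y <- l | y \in No].
  apply: eq_in_filter => y yl; rewrite !inE; case: eqP => // E.
  by rewrite -E yl in xl.
by rewrite set_cons setDDl setUCA setUA.
Qed.

(** Invariant of a running minimum, for an arbitrary initial pair so that the induction goes
    through. The last clause ties the recorded value to the recorded point. *)
Lemma foldl_update_best (R : realFieldType) (n : nat)
    (d : 'I_n -> 'I_n -> R) (ordl : 'I_n -> seq 'I_n) (No : {set 'I_n})
    (s : nat) (points : seq 'I_n) (best : option 'I_n * R) :
  let r i := d i (scan_loop No s 0 i (ordl i)) in
  let res := foldl (update_best d ordl No s) best points in
  [/\ res.2 <= best.2, {in points, forall j, res.2 <= r j}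
    & res = best \/ exists2 i, i \in points & res = (Some i, r i)].
Proof.
elim: points best => [|x p IHp] best r res; first by split => //; left.
have [le1 le2 H] := IHp (update_best d ordl No s best x).
rewrite -[foldl _ _ _]/res in le1 le2 H.
have [b1 b2] : (update_best d ordl No s best x).2 <= best.2 /\
               (update_best d ordl No s best x).2 <= r x.
  by rewrite /update_best /r; case: ltP => // ?; split=> //; apply: ltW.
split.
- exact: le_trans b1.
- by move=> j; rewrite inE => /orP[/eqP -> | /le2 //]; apply: le_trans b2.
case: H => [E | [i ip E]]; last by right; exists i; rewrite ?inE ?ip ?orbT.
rewrite E /update_best; case: ifP => _; last by left.
by right; exists x; rewrite ?mem_head.
Qed.

Lemma MinMax_distance_algorithmP (R : realFieldType) (n : nat)
    (d : 'I_n -> 'I_n -> R) (ordl : 'I_n -> seq 'I_n) (Large : R)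
    (No : {set 'I_n}) (s : nat) (points : seq 'I_n) (i0 : 'I_n) :
  let r i := d i (scan_loop No s 0 i (ordl i)) in
  (forall i j, d i j < Large) -> i0 \in points ->
  exists i, [/\ i \in points,
    MinMax_distance_algorithm d ordl Large No s points = Some i
    & {in points, forall j, r i <= r j}].
Proof.
move=> r LargeP i0p; rewrite /MinMax_distance_algorithm.
have [_ le2] := foldl_update_best d ordl No s points (None, Large).
case=> [E | [i ip E]]; rewrite E in le2 *; last by exists i.
(* If no point were selected, the best distance would still be [Large], yet it is at most [r i0],
   which is below [Large]. *)
by have := le2 _ i0p; rewrite /= leNgt LargeP.
Qed.

(** * The nearest available points form an optimal cluster around a given point *)

Lemma size_available (R : realFieldType) (n : nat) (d : 'I_n -> 'I_n -> R)
    (No : {set 'I_n}) (i : 'I_n) (l : seq 'I_n) :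
  distance_ordering d i l -> i \in No ->
  size [seq j <- l | j \in No] = #|No|.-1.
Proof.
case=> pl _ iNo; rewrite (perm_size (perm_filter _ pl)) (cardsD1 i) iNo /=.
rewrite cardE; apply/perm_size/uniq_perm; last 1 first.
- by move=> x; rewrite mem_filter !mem_enum !inE andbC.
- exact/filter_uniq/enum_uniq.
- exact: enum_uniq.
Qed.

Lemma uniq_ordering (R : realFieldType) (n : nat) (d : 'I_n -> 'I_n -> R)
    (i : 'I_n) (l : seq 'I_n) : distance_ordering d i l -> uniq l.
Proof. by case=> pl _; rewrite (perm_uniq pl) enum_uniq. Qed.

Lemma notin_nearest (R : realFieldType) (n : nat) (d : 'I_n -> 'I_n -> R)
    (No : {set 'I_n}) (s : nat) (i : 'I_n) (l : seq 'I_n) :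
  distance_ordering d i l -> i \notin nearest No s l.
Proof.
case=> pl _; apply/negP => /mem_take; rewrite mem_filter (perm_mem pl).
by rewrite mem_enum !inE eqxx andbF.
Qed.

Lemma nearest_available (n : nat) (No : {set 'I_n}) (s : nat) (l : seq 'I_n) :
  {subset nearest No s l <= No}.
Proof. by move=> x /mem_take; rewrite mem_filter => /andP[]. Qed.

Lemma nearest_le_last (R : realFieldType) (n : nat) (d : 'I_n -> 'I_n -> R)
    (No : {set 'I_n}) (s : nat) (i : 'I_n) (l : seq 'I_n) :
  distance_ordering d i l ->
  {in nearest No s l, forall j, d i j <= d i (last i (nearest No s l))}.
Proof.
case=> _ srt j.
have tr : transitive (fun j j' => d i j <= d i j').
  by move=> a b c; apply: le_trans.
have : sorted (fun j j' => d i j <= d i j') (nearest No s l).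
  by rewrite take_sorted // sorted_filter.
elim/last_ind: (nearest No s l) => // p x _; rewrite last_rcons.
rewrite -cats1 sorted_pairwise // pairwise_cat => /and3P[/allrelP H _ _].
by rewrite mem_cat inE => /orP[jp | /eqP -> //]; apply: H; rewrite ?mem_head.
Qed.

(* By counting, [C :\ i] contains a point that is not among the first [s - 1]
   available points of [l]. *)
Lemma MaxDist_ge_last (R : realFieldType) (n : nat) (d : 'I_n -> 'I_n -> R)
    (No C : {set 'I_n}) (s : nat) (i : 'I_n) (l : seq 'I_n) :
  d i i = 0 -> distance_ordering d i l -> C \subset No -> #|C| = s.+1 ->
  i \in C -> d i (last i (nearest No s l)) <= MaxDist d i C.
Proof.
move=> dii [pl srt] CNo cC iC; have cD : #|C :\ i| = s.
  by move: cC; rewrite (cardsD1 i) iC => -[].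
case: s cC cD => [|s] cC cD.
  (* Here [C] is the singleton of [i]: the scan stops at [i] itself, and [d i i = 0] agrees with the
     value of [max_seq] on the empty list. *)
  by rewrite /nearest take0 /= dii /MaxDist (cards0_eq cD) /image_mem enum_set0.
set L := [seq j <- l | j \in No].
have tr : transitive (fun j j' => d i j <= d i j').
  by move=> a b c; apply: le_trans.
have sL : sorted (fun j j' => d i j <= d i j') L by rewrite sorted_filter.
have CL : {subset C :\ i <= L}.
  move=> j; rewrite !inE mem_filter (perm_mem pl) mem_enum !inE => /andP[-> jC].
  by rewrite (subsetP CNo).
have sz : (s < size L)%N.
  rewrite -cD cardE; apply: uniq_leq_size; first exact: enum_uniq.
  by move=> j; rewrite mem_enum => /CL.
have lastE : last i (nearest No s.+1 l) = nth i L s.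
  by rewrite -nth_last size_takel //= nth_take.
have [j jC jL] : exists2 j, j \in C :\ i & j \notin take s L.
  apply/exists_inP; rewrite -negb_forall_in; apply/negP => /forall_inP H.
  have : (#|C :\ i| <= size (take s L))%N.
    rewrite cardE; apply: uniq_leq_size; first exact: enum_uniq.
    by move=> j; rewrite mem_enum => /H.
  by rewrite cD size_takel ?ltnn // ltnW.
rewrite lastE; apply: (@le_trans _ _ (d i j)); last first.
  exact: max_seq_ge (image_f (d i) jC).
have jL' := CL _ jC; rewrite -(nth_index i jL').
(* Being outside the first [s] entries of [L], [j] occurs at or after position [s], so sortedness
   compares it with the point where the scan stops. *)
have sj : (s <= index j L)%N.
  by rewrite leqNgt -(in_take s jL').
apply: (sorted_leq_nth tr _ i sL) => //.
by rewrite inE index_mem.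
Qed.

(** The maximum is attained at a selected point, and the last selected point is the farthest. With
    [MaxDist_ge_last], this makes the scan distance the least possible [MaxDist] around [i]. *)
Lemma MaxDist_nearest (R : realFieldType) (n : nat) (d : 'I_n -> 'I_n -> R)
    (No : {set 'I_n}) (s : nat) (i : 'I_n) (l : seq 'I_n) :
  d i i = 0 -> distance_ordering d i l ->
  MaxDist d i (i |: [set x in nearest No s l]) <=
    d i (last i (nearest No s l)).
Proof.
move=> dii ol; rewrite /MaxDist setU1K ?inE ?(notin_nearest _ _ ol) //.
have le := nearest_le_last (No := No) (s := s) ol.
case: (set_0Vmem [set x in nearest No s l]) => [E | [j jn]].
  rewrite E /image_mem enum_set0 /=.
  by case: (nearest _ _ _) E => [|x p /setP/(_ x)]; rewrite ?dii // !inE eqxx.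
have /imageP[j' + ->] := max_seq_in (image_neq_nil (d i) jn).
by rewrite inE; apply: le.
Qed.

Lemma card_nearest (R : realFieldType) (n : nat) (d : 'I_n -> 'I_n -> R)
    (No : {set 'I_n}) (s : nat) (i : 'I_n) (l : seq 'I_n) :
  distance_ordering d i l -> i \in No -> (s < #|No|)%N ->
  #|i |: [set x in nearest No s l]| = s.+1.
Proof.
move=> ol iNo sNo; rewrite cardsU1 inE (notin_nearest _ _ ol) cardsE.
rewrite (card_uniqP _) ?take_uniq ?filter_uniq ?(uniq_ordering ol) //.
by rewrite size_takel // (size_available ol iNo); lia.
Qed.

(** * One iteration, and the invariant of the whole run *)

Lemma iterationP (R : realFieldType) (n : nat) (d : 'I_n -> 'I_n -> R)
    (ordl : 'I_n -> seq 'I_n) (visit : {set 'I_n} -> seq 'I_n) (Large : R)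
    (ko : nat) (st : state n) :
  let No := avail st in
  let v := cluster_size (navail st) ko in
  let r i := d i (last i (nearest No v.-1 (ordl i))) in
  (forall i, distance_ordering d i (ordl i)) ->
  (forall S : {set 'I_n}, perm_eq (visit S) (enum S)) ->
  (forall i j, d i j < Large) -> (0 < v <= #|No|)%N ->
  exists i, let C := i |: [set x in nearest No v.-1 (ordl i)] in
    [/\ i \in No, {in No, forall j, r i <= r j}
      & iteration d ordl visit Large ko st =
        Outcome (State (No :\: C) (navail st - v)) C (Some i)].
Proof.
move=> No v r ordlP visitP LargeP /andP[v0 vNo].
have visitE S : visit S =i S by move=> x; rewrite (perm_mem (visitP S)) mem_enum.
have /card_gt0P[i0 i0No] : (0 < #|No|)%N by apply: leq_trans vNo.
rewrite -visitE in i0No.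
have [i [iNo E min]] := MinMax_distance_algorithmP ordl No v.-1 LargeP i0No.
(* As [v <= #|No|], each available [j] has at least [v - 1] other available points in its list, so
   the closed form of the scan applies. *)
have rE : {in No, forall j, r j = d j (scan_loop No v.-1 0 j (ordl j))}.
  move=> j jNo; rewrite scan_loopE ?subn0 //.
  by rewrite (size_available (ordlP j)) //; lia.
rewrite visitE in iNo; exists i; split=> //.
  by move=> j jNo; rewrite !rE // min // visitE.
rewrite /iteration -/v -/No subn1 E generate_loopE ?(uniq_ordering (ordlP i)) //.
by rewrite subn0 setU0 setDDl setUC.
Qed.

(** The program variable agrees with the true cardinal, and there are at least as many available
    points as clusters still to be formed, so no iteration runs short of points. *)
Lemma state_after_invariant (R : realFieldType) (n : nat)
    (d : 'I_n -> 'I_n -> R) (ordl : 'I_n -> seq 'I_n)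
    (visit : {set 'I_n} -> seq 'I_n) (Large : R) (k t : nat) :
  (forall i, distance_ordering d i (ordl i)) ->
  (forall S : {set 'I_n}, perm_eq (visit S) (enum S)) ->
  (forall i j, d i j < Large) -> (k <= n)%N -> (t <= k)%N ->
  let st := state_after d ordl visit Large k t in
  navail st = #|avail st| /\ (k - t <= #|avail st|)%N.
Proof.
move=> ordlP visitP LargeP kn; elim: t => [_|t IHt tk].
  by rewrite /= cardsT card_ord subn0.
have [navE le] := IHt (ltnW tk).
rewrite [state_after _ _ _ _ _ _]/=.
move: (state_after d ordl visit Large k t) navE le => st navE le.
have ko0 : (0 < k - t)%N by rewrite subn_gt0.
have [] := cluster_size_bounds ko0 (leq_trans ko0 le).
set v := cluster_size _ _ => v0 vlt _.
have vle : (v <= #|avail st|)%N by nia.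
have := @iterationP R n d ordl visit Large (k - t) st ordlP visitP LargeP.
rewrite navE -/v v0 => /(_ vle)[i [iNo _ ->]] /=.
have -> : #|avail st :\: (i |: [set x in nearest (avail st) v.-1 (ordl i)])|
          = (#|avail st| - v)%N.
  rewrite cardsD (setIidPr _); last first.
    apply/subsetP => x; rewrite !inE => /orP[/eqP -> // |].
    exact: nearest_available.
  by rewrite (card_nearest (ordlP i)) // prednK.
(* Put [m = k - t] and [a = #|avail st|]. From [(v - 1) * m < a] follows
   [a - v >= (v - 1) * (m - 1)], which suffices if [v >= 2]; if [v = 1], use [m <= a]. *)
by split=> //; nia.
Qed.

Theorem theorem1 (R : realFieldType) (n : nat) (d : 'I_n -> 'I_n -> R)
    (d_diag : forall i : 'I_n, d i i = 0)
    (k : nat) (hk : (1 <= k <= n)%N)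
    (ordl : 'I_n -> seq 'I_n)
    (ordlP : forall i : 'I_n, distance_ordering d i (ordl i))
    (visit : {set 'I_n} -> seq 'I_n)
    (visitP : forall S : {set 'I_n}, perm_eq (visit S) (enum S))
    (Large : R) (Large_gt0 : 0 < Large)
    (LargeP : forall i j : 'I_n, d i j < Large)
    (ko : nat) (hko : (1 <= ko <= k)%N) :
  let st := state_after d ordl visit Large k (k - ko) in
  let No := avail st in
  let v := cluster_size #|No| ko in
  let C := cluster (iteration d ordl visit Large ko st) in
  exists istar : 'I_n,
    [/\ center (iteration d ordl visit Large ko st) = Some istar,
        best_cluster d No v C
      & MinMax_centroid d C istar].
Proof.
case/andP: hk => _ kn; case/andP: hko => ko0 kok.
move=> st No v C; rewrite /C.
have [navE] := state_after_invariant ordlP visitP LargeP kn (leq_subr ko k).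
rewrite subKn // -/st -/No in navE * => koNo.
have [v0 vlt _] := cluster_size_bounds ko0 (leq_trans ko0 koNo).
rewrite -/v in v0 vlt.
have vle : (v <= #|No|)%N by nia.
have := @iterationP R n d ordl visit Large ko st ordlP visitP LargeP.
rewrite navE -/No -/v v0 => /(_ vle)[i [iNo min ->]] /=.
set B := i |: _; exists i.
have iB : i \in B by rewrite setU11.
have BNo : B \subset No.
  apply/subsetP => x; rewrite !inE => /orP[/eqP -> // |].
  exact: nearest_available.
have cB : #|B| = v by rewrite (card_nearest (ordlP i)) ?prednK.
(* Bounding [MaxDist d i B] rather than [MMSpan d B] gives more: the case where [C'] is [B] shows
   that [i] is a centroid of [B]. *)
have leB C' : C' \in CSet No v -> MaxDist d i B <= MMSpan d C'.
  rewrite inE => /andP[C'No /eqP cC'].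
  have /card_gt0P[j jC'] : (0 < #|C'|)%N by rewrite cC'.
  have [m mC' ->] := MMSpan_attained d jC'.
  apply: le_trans (MaxDist_nearest No v.-1 (d_diag i) (ordlP i)) _.
  apply: le_trans (min _ (subsetP C'No _ mC')) _.
  by apply: MaxDist_ge_last => //; rewrite prednK.
have BC : B \in CSet No v by rewrite inE BNo cB eqxx.
have spanB : MaxDist d i B = MMSpan d B.
  by apply: le_anti; rewrite leB // MMSpan_le.
split=> //; split=> //; apply: le_anti.
rewrite (min_seq_le (image_f (fun C' => MMSpan d C') BC)) andbT.
have /imageP[C' C'C ->] :=
  min_seq_in (image_neq_nil (fun C' => MMSpan d C') BC).
by rewrite -spanB leB.
Qed.
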